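(* Let $L/F_0$ be a cyclic Galois field extension of degree $n$ with $\mathrm{Gal}(L/F_0)=\langle\sigma\rangle$ and $F/F_0$ a cyclic Galois field extension of degree $m$ with $\mathrm{Gal}(F/F_0)=\langle\tau\rangle$, with $L$ and $F$ linearly disjoint over $F_0$, and let $K=L\otimes_{F_0}F$ be their composite. Let $(F/F_0,\tau,d)$ be an associative or nonassociative cyclic algebra of degree $m$ (so $d\in F^\times$). Let $D_0=(L/F_0,\sigma,c)$ be an associative cyclic algebra over $F_0$ of degree $n$ (so $c\in F_0^\times$) such that $D=D_0\otimes_{F_0}F=(K/F,\sigma,c)$ is a division algebra. Then $$(L/F_0,\sigma,c)\otimes_{F_0}(F/F_0,\tau,d)$$ is a division algebra if and only if $f(t)=t^m-d\in D[t;\widetilde\tau^{-1}]$ is irreducible.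
   Context: Algebras are unital but not necessarily associative. A nonzero algebra $A$ is a division algebra if for every $a\ne0$ in $A$ the left and right multiplications by $a$ are bijective. Cyclic algebras: for a cyclic Galois extension $E/k$ of degree $r$ with $\mathrm{Gal}(E/k)=\langle\rho\rangle$ and $a\in E^\times$, $(E/k,\rho,a)=E\oplus eE\oplus\dots\oplus e^{r-1}E$ is the $k$-algebra with biadditive multiplication, for $x,y\in E$, $0\le i,j<r$, $(e^ix)(e^jy)=e^{i+j}\rho^j(x)y$ if $i+j<r$, and $(e^ix)(e^jy)=e^{(i+j)-r}a\rho^j(x)y$ if $i+j\ge r$. It is associative if $a\in k^\times$ (an associative cyclic algebra), and is called a nonassociative cyclic algebra if $a\in E\setminus k$. Extensions: $\sigma$ and $\tau$ are canonically extended to $K$: $\sigma$ is the identity on $F$, and $\tau$ is the identity on $L$. The map $\widetilde\tau$: on $D=(K/F,\sigma,c)$, $\widetilde\tau(\sum_i e^ix_i)=\sum_i e^i\tau(x_i)$ ($x_i\in K$); it is a ring automorphism of $D$. Twisted polynomial ring: $D[t;\rho]$ ($\rho$ a ring automorphism of $D$) is the ring of polynomials $\sum a_it^i$, $a_i\in D$, with term-wise addition and multiplication determined by $ta=\rho(a)t$. An element $f$ is irreducible if it is not a unit and there are no $g,h\in D[t;\rho]$ with $\deg g,\deg h<\deg f$ and $f=gh$. *)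

(* Defs.v *)
From HB Require Import structures.
From mathcomp Require Import all_boot all_order all_algebra all_fingroup.
From mathcomp Require Import all_solvable all_field.

Set Implicit Arguments.
Unset Strict Implicit.
Unset Printing Implicit Defensive.

Import GRing.Theory.
Local Open Scope ring_scope.

HB.mixin Record isNonassocAlgebra (k : fieldType) A of Vector k A := {
  namul : A -> A -> A;
  naone : A;
  namulDl : left_distributive namul +%R;
  namulDr : right_distributive namul +%R;
  namulZl : forall (s : k) (u v : A), namul (s *: u) v = s *: namul u v;
  namulZr : forall (s : k) (u v : A), namul u (s *: v) = s *: namul u v;
  na1mul : left_id naone namul;
  namul1 : right_id naone namul
}.

(* Finite-dimensional unital algebras, not necessarily associative. *)
#[short(type="nonassocAlgType")]
HB.structure Definition NonassocAlgebra (k : fieldType) :=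
  {A of isNonassocAlgebra k A & Vector k A}.

Definition is_division_algebra (k : fieldType) (A : nonassocAlgType k) : Prop :=
  (exists a : A, a != 0) /\
  forall a : A, a != 0 ->
    bijective (fun x : A => namul a x) /\ bijective (fun x : A => namul x a).

Section CyclicAlgebra.
Variables (k : fieldType) (E : splittingFieldType k) (rho : gal_of {:E}).

(* The coefficient of e^i is the value at i.  When E/k is cyclic Galois with
   group generated by rho, the number of coefficients #[rho] is [E : k]; indexing
   by #[rho] makes the algebra laws hold without assuming this. *)
Definition cyclic_algebra (a : E) : Type := {ffun 'I_#[rho]%g -> E}.

HB.instance Definition _ (a : E) :=
  Vector.copy (cyclic_algebra a) {ffun 'I_#[rho]%g -> E}.

(* e^i x, for i < #[rho] *)
Definition cyclic_mono (a : E) (i : nat) (x : E) : cyclic_algebra a :=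
  [ffun l : 'I_#[rho]%g => if val l == i then x else 0].

Definition cyclic_mul (a : E) (u v : cyclic_algebra a) : cyclic_algebra a :=
  \sum_(i < #[rho]%g) \sum_(j < #[rho]%g)
    if (i + j < #[rho]%g)%N
    then cyclic_mono a (i + j) ((rho ^+ j)%g (u i) * v j)
    else cyclic_mono a (i + j - #[rho]%g) (a * (rho ^+ j)%g (u i) * v j).

Definition cyclic_one (a : E) : cyclic_algebra a := cyclic_mono a 0 1.

Section Laws.
Variable a : E.
Local Notation r := #[rho]%g.
Local Notation mono := (cyclic_mono a).
Local Notation "u ** v" := (@cyclic_mul a u v) (at level 40).

Lemma cyclic_mono0 i : mono i 0 = 0.
Proof. by apply/ffunP=> l; rewrite !ffunE if_same. Qed.

Lemma cyclic_monoD i : {morph mono i : x y / x + y}.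
Proof.
by move=> x y; apply/ffunP=> l; rewrite !ffunE; case: ifP; rewrite ?addr0.
Qed.

Lemma cyclic_monoZ i (s : k) x : mono i (s *: x) = s *: mono i x.
Proof. by apply/ffunP=> l; rewrite !ffunE; case: ifP; rewrite ?scaler0. Qed.

Lemma cyclic_decomp (u : cyclic_algebra a) : u = \sum_(i < r) mono i (u i).
Proof.
apply/ffunP=> l; rewrite sum_ffunE (bigD1 l) //= ffunE eqxx big1 ?addr0 //.
by move=> i nil; rewrite ffunE; case: eqP => // /val_inj eli; rewrite eli eqxx in nil.
Qed.

Lemma cyclic_mulDl : left_distributive (@cyclic_mul a) +%R.
Proof.
move=> u v w; rewrite /cyclic_mul -big_split; apply: eq_bigr => i _.
rewrite -big_split; apply: eq_bigr => j _ /=.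
by case: ifP => _; rewrite ffunE -cyclic_monoD rmorphD ?mulrDr mulrDl.
Qed.

Lemma cyclic_mulDr : right_distributive (@cyclic_mul a) +%R.
Proof.
move=> u v w; rewrite /cyclic_mul -big_split; apply: eq_bigr => i _.
rewrite -big_split; apply: eq_bigr => j _ /=.
by case: ifP => _; rewrite ffunE -cyclic_monoD mulrDr.
Qed.

Lemma cyclic_mulZl (s : k) (u v : cyclic_algebra a) :
  (s *: u) ** v = s *: (u ** v).
Proof.
rewrite /cyclic_mul scaler_sumr; apply: eq_bigr => i _.
rewrite scaler_sumr; apply: eq_bigr => j _ /=.
by case: ifP => _; rewrite ffunE -cyclic_monoZ linearZ /= -?scalerAr -scalerAl.
Qed.

Lemma cyclic_mulZr (s : k) (u v : cyclic_algebra a) :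
  u ** (s *: v) = s *: (u ** v).
Proof.
rewrite /cyclic_mul scaler_sumr; apply: eq_bigr => i _.
rewrite scaler_sumr; apply: eq_bigr => j _ /=.
by case: ifP => _; rewrite ffunE -cyclic_monoZ -scalerAr.
Qed.

Lemma cyclic_mono_mul i j x y : (i < r)%N -> (j < r)%N ->
  mono i x ** mono j y =
  if (i + j < r)%N then mono (i + j) ((rho ^+ j)%g x * y)
  else mono (i + j - r) (a * (rho ^+ j)%g x * y).
Proof.
move=> lti ltj; rewrite /cyclic_mul (bigD1 (Ordinal lti)) //=.
rewrite (bigD1 (Ordinal ltj)) //= !ffunE !eqxx.
rewrite big1 ?addr0 => [|j' nj]; last first.
  have nj': (j' == j :> nat) = false by apply: contraNF nj => /eqP ej; apply/eqP/val_inj.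
  by rewrite !ffunE nj' !mulr0 !cyclic_mono0 if_same.
rewrite big1 ?addr0 // => i' ni; rewrite big1 // => j' _.
have ni': (i' == i :> nat) = false by apply: contraNF ni => /eqP ei; apply/eqP/val_inj.
by rewrite !ffunE ni' rmorph0 !(mulr0, mul0r) !cyclic_mono0 if_same.
Qed.

Lemma cyclic_mul0l u : 0 ** u = 0.
Proof. by apply: (addrI (0 ** u)); rewrite -cyclic_mulDl !addr0. Qed.

Lemma cyclic_mul0r u : u ** 0 = 0.
Proof. by apply: (addrI (u ** 0)); rewrite -cyclic_mulDr !addr0. Qed.

Lemma cyclic_mul_suml I (s : seq I) (G : I -> cyclic_algebra a) v :
  (\sum_(i <- s) G i) ** v = \sum_(i <- s) G i ** v.
Proof.
exact: (big_morph (fun u => u ** v) (fun x y => cyclic_mulDl x y v) (cyclic_mul0l v)).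
Qed.

Lemma cyclic_mul_sumr I (s : seq I) (G : I -> cyclic_algebra a) v :
  v ** (\sum_(i <- s) G i) = \sum_(i <- s) v ** G i.
Proof.
exact: (big_morph (fun u => v ** u) (cyclic_mulDr v) (cyclic_mul0r v)).
Qed.

Lemma cyclic_mul1 : left_id (cyclic_one a) (@cyclic_mul a).
Proof.
move=> u; rewrite {1}(cyclic_decomp u) cyclic_mul_sumr {2}(cyclic_decomp u).
apply: eq_bigr => i _; rewrite cyclic_mono_mul ?order_gt0 // add0n ltn_ord.
by rewrite rmorph1 mul1r.
Qed.

Lemma cyclic_1mul : right_id (cyclic_one a) (@cyclic_mul a).
Proof.
move=> u; rewrite {1}(cyclic_decomp u) cyclic_mul_suml {2}(cyclic_decomp u).
apply: eq_bigr => i _; rewrite cyclic_mono_mul ?order_gt0 // addn0 ltn_ord.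
by rewrite expg0 gal_id mulr1.
Qed.

End Laws.

HB.instance Definition _ (a : E) :=
  isNonassocAlgebra.Build k (cyclic_algebra a)
    (@cyclic_mulDl a) (@cyclic_mulDr a) (@cyclic_mulZl a) (@cyclic_mulZr a)
    (@cyclic_mul1 a) (@cyclic_1mul a).

Section Associative.
Variable c : k.
Local Notation a := (c *: (1 : E)).
Local Notation r := #[rho]%g.
Local Notation "u ** v" := (@cyclic_mul a u v) (at level 40).

(* e^i x for arbitrary i, using e^r = c *)
Let emono (i : nat) (x : E) : cyclic_algebra a :=
  cyclic_mono a (i %% r) (a ^+ (i %/ r) * x).

Let emono_mul i j x y :
  emono i x ** emono j y = emono (i + j) ((rho ^+ j)%g x * y).
Proof.
have rho_c n l : (rho ^+ n)%g (a ^+ l) = a ^+ l by rewrite rmorphXn /= linearZ /= rmorph1.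
rewrite /emono cyclic_mono_mul ?ltn_mod ?order_gt0 // rmorphM /= rho_c expg_mod_order.
have r0 : (0 < r)%N := order_gt0 rho.
have lti : (i %% r < r)%N by rewrite ltn_mod.
have ltj : (j %% r < r)%N by rewrite ltn_mod.
have e_ij : (i + j = (i %/ r + j %/ r) * r + (i %% r + j %% r))%N.
  by rewrite {1}(divn_eq i r) {1}(divn_eq j r) mulnDl addnACA.
have norm q s : (s < r)%N -> (i + j = q * r + s)%N ->
    ((i + j) %% r = s)%N * ((i + j) %/ r = q)%N.
  by move=> lts ->; rewrite modnMDl divnMDl // modn_small // divn_small // addn0.
case: ifPn => [lt_ij|]; last rewrite -leqNgt => ge_ij.
  rewrite !(norm _ _ lt_ij e_ij) exprD -!mulrA.
  by congr (cyclic_mono _ _ (_ * _)); rewrite mulrCA.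
have lt_ij: (i %% r + j %% r - r < r)%N by rewrite ltn_subLR // (leq_trans (_ : _ < r + j %% r)%N) ?ltn_add2r // leq_add2l ltnW.
have e_ij' : (i + j = (i %/ r + j %/ r).+1 * r + (i %% r + j %% r - r))%N.
  by rewrite {1}e_ij mulSnr -addnA subnKC.
rewrite !(norm _ _ lt_ij e_ij') exprS exprD -!mulrA.
by congr (cyclic_mono _ _ (_ * (_ * _))); rewrite mulrCA.
Qed.

Let emono_decomp (u : cyclic_algebra a) : u = \sum_(i < r) emono i (u i).
Proof.
rewrite {1}(cyclic_decomp u); apply: eq_bigr => i _.
by rewrite /emono modn_small // divn_small // expr0 mul1r.
Qed.

Fact cyclic_mulA : associative (@cyclic_mul a).
Proof.
have mulA3 i j x y w :
    emono i x ** (emono j y ** w) = (emono i x ** emono j y) ** w.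
  rewrite (emono_decomp w) (cyclic_mul_sumr _ _ (emono j y)).
  rewrite (cyclic_mul_sumr _ _ (emono i x)) (cyclic_mul_sumr _ _ (_ ** _)).
  apply: eq_bigr => l _; rewrite !emono_mul addnA rmorphM /= mulrA.
  by rewrite expgD galM ?memvf.
have mulA2 i x v w : emono i x ** (v ** w) = (emono i x ** v) ** w.
  rewrite (emono_decomp v) (cyclic_mul_suml _ _ w) !(cyclic_mul_sumr _ _ (emono i x)).
  by rewrite (cyclic_mul_suml _ _ w); apply: eq_bigr => j _; apply: mulA3.
move=> u v w; rewrite (emono_decomp u) (cyclic_mul_suml _ _ (v ** w)).
rewrite (cyclic_mul_suml _ _ v) (cyclic_mul_suml _ _ w).
by apply: eq_bigr => i _; apply: mulA2.
Qed.

Fact cyclic_one_neq0 : cyclic_one a != 0.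
Proof.
apply/eqP=> /ffunP/(_ (Ordinal (order_gt0 rho))).
by rewrite !ffunE eqxx => /eqP; rewrite oner_eq0.
Qed.

HB.instance Definition _ :=
  GRing.Zmodule_isNzRing.Build (cyclic_algebra a)
    cyclic_mulA (@cyclic_mul1 a) (@cyclic_1mul a)
    (@cyclic_mulDl a) (@cyclic_mulDr a) cyclic_one_neq0.

End Associative.
End CyclicAlgebra.

Section TensorProduct.
Variables (k : fieldType) (A B : nonassocAlgType k).
Local Notation bA := (vbasis {:A}).
Local Notation bB := (vbasis {:B}).

(* The entry at (i, j) is the coordinate on bA`_i (x) bB`_j. *)
Definition tensor : Type := 'M[k]_(\dim {:A}, \dim {:B}).

HB.instance Definition _ := Vector.copy tensor 'M[k]_(\dim {:A}, \dim {:B}).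

Definition tens (a : A) (b : B) : tensor :=
  \matrix_(i, j) (coord bA i a * coord bB j b).

(* The bilinear product with (a (x) b)(a' (x) b') = aa' (x) bb' (tensor_mul_tens). *)
Definition tensor_mul (M N : tensor) : tensor :=
  \sum_i \sum_j \sum_i' \sum_j' (M i j * N i' j') *:
    tens (namul bA`_i bA`_i') (namul bB`_j bB`_j').

Lemma tensDl b : {morph tens^~ b : x y / x + y}.
Proof. by move=> x y; apply/matrixP=> i j; rewrite !mxE linearD mulrDl. Qed.

Lemma tensDr a : {morph tens a : x y / x + y}.
Proof. by move=> x y; apply/matrixP=> i j; rewrite !mxE linearD mulrDr. Qed.

Lemma tensZl s a b : tens (s *: a) b = s *: tens a b.
Proof. by apply/matrixP=> i j; rewrite !mxE linearZ mulrA. Qed.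

Lemma tensZr s a b : tens a (s *: b) = s *: tens a b.
Proof. by apply/matrixP=> i j; rewrite !mxE linearZ mulrCA. Qed.

Lemma tensor_decomp (M : tensor) :
  M = \sum_i \sum_j M i j *: tens bA`_i bB`_j.
Proof.
have fA : free bA := basis_free (vbasisP _).
have fB : free bB := basis_free (vbasisP _).
apply/matrixP=> i j; rewrite summxE (bigD1 i) //= summxE (bigD1 j) //=.
rewrite !mxE !coord_free // !eqxx !mulr1 big1 ?addr0 => [|j' nj]; last first.
  by rewrite !mxE !coord_free // (negPf nj) !mulr0.
rewrite big1 ?addr0 // => i' ni; rewrite summxE big1 // => j' _.
by rewrite !mxE !coord_free // (negPf ni) mul0r mulr0.
Qed.

Lemma tensor_mulDl : left_distributive tensor_mul +%R.
Proof.
move=> M N P; rewrite /tensor_mul; do 4![rewrite -big_split; apply: eq_bigr => ? _].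
by rewrite mxE mulrDl scalerDl.
Qed.

Lemma tensor_mulDr : right_distributive tensor_mul +%R.
Proof.
move=> M N P; rewrite /tensor_mul; do 4![rewrite -big_split; apply: eq_bigr => ? _].
by rewrite mxE mulrDr scalerDl.
Qed.

Lemma tensor_mulZl s M N : tensor_mul (s *: M) N = s *: tensor_mul M N.
Proof.
rewrite /tensor_mul; do 4![rewrite scaler_sumr; apply: eq_bigr => ? _].
by rewrite mxE scalerA mulrA.
Qed.

Lemma tensor_mulZr s M N : tensor_mul M (s *: N) = s *: tensor_mul M N.
Proof.
rewrite /tensor_mul; do 4![rewrite scaler_sumr; apply: eq_bigr => ? _].
by rewrite mxE scalerA mulrCA.
Qed.

Let tens_suml I (s : seq I) (G : I -> A) b :
  tens (\sum_(i <- s) G i) b = \sum_(i <- s) tens (G i) b.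
Proof.
apply: (big_morph (tens^~ b) (tensDl b)).
by rewrite -[in LHS](scale0r (0 : A)) tensZl scale0r.
Qed.

Let tens_sumr I (s : seq I) (G : I -> B) a :
  tens a (\sum_(i <- s) G i) = \sum_(i <- s) tens a (G i).
Proof.
apply: (big_morph (tens a) (tensDr a)).
by rewrite -[in LHS](scale0r (0 : B)) tensZr scale0r.
Qed.

Let namul_suml (C : nonassocAlgType k) I (s : seq I) (G : I -> C) v :
  namul (\sum_(i <- s) G i) v = \sum_(i <- s) namul (G i) v.
Proof.
apply: (big_morph (fun u => namul u v) (fun x y => namulDl x y v)).
by rewrite -[in LHS](scale0r (0 : C)) namulZl scale0r.
Qed.

Let namul_sumr (C : nonassocAlgType k) I (s : seq I) (G : I -> C) v :
  namul v (\sum_(i <- s) G i) = \sum_(i <- s) namul v (G i).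
Proof.
apply: (big_morph (fun u => namul v u) (namulDr v)).
by rewrite -[in LHS](scale0r (0 : C)) namulZr scale0r.
Qed.

Lemma tensor_mul_tens a b a' b' :
  tensor_mul (tens a b) (tens a' b') = tens (namul a a') (namul b b').
Proof.
rewrite {2}(coord_vbasis (memvf a)) {2}(coord_vbasis (memvf a')).
rewrite {2}(coord_vbasis (memvf b)) {2}(coord_vbasis (memvf b')).
rewrite namul_suml tens_suml; apply: eq_bigr => i _.
rewrite namul_suml tens_sumr; apply: eq_bigr => j _.
rewrite namul_sumr tens_suml; apply: eq_bigr => i' _.
rewrite namul_sumr tens_sumr; apply: eq_bigr => j' _.
rewrite !(namulZl, namulZr) !(tensZl, tensZr) !scalerA !mxE.
by rewrite [in LHS]mulrACA mulrA.
Qed.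

Fact tensor_1mul : left_id (tens (naone : A) (naone : B)) tensor_mul.
Proof.
move=> M; rewrite {2}(tensor_decomp M) {1}(tensor_decomp M).
have D x y := tensor_mulDr (tens naone naone) x y.
have Z : tensor_mul (tens naone naone) 0 = 0.
  by rewrite -(scale0r (0 : tensor)) tensor_mulZr !scale0r.
rewrite (big_morph _ D Z); apply: eq_bigr => i _.
rewrite (big_morph _ D Z); apply: eq_bigr => j _.
by rewrite tensor_mulZr tensor_mul_tens !na1mul.
Qed.

Fact tensor_mul1 : right_id (tens (naone : A) (naone : B)) tensor_mul.
Proof.
move=> M; rewrite {2}(tensor_decomp M) {1}(tensor_decomp M).
have D x y := tensor_mulDl x y (tens naone naone).
have Z : tensor_mul 0 (tens naone naone) = 0.
  by rewrite -(scale0r (0 : tensor)) tensor_mulZl !scale0r.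
rewrite (big_morph (tensor_mul^~ _) D Z); apply: eq_bigr => i _.
rewrite (big_morph (tensor_mul^~ _) D Z); apply: eq_bigr => j _.
by rewrite tensor_mulZl tensor_mul_tens !namul1.
Qed.

HB.instance Definition _ :=
  isNonassocAlgebra.Build k tensor tensor_mulDl tensor_mulDr
    tensor_mulZl tensor_mulZr tensor_1mul tensor_mul1.

End TensorProduct.

Section TwistedPolynomial.
Variables (D : nzRingType) (rho : {rmorphism D -> D}).

(* D[t; rho], coefficients written on the left: t a = rho(a) t *)
Definition twisted_poly of {rmorphism D -> D} : Type := {poly D}.
Local Notation P := (twisted_poly rho).

HB.instance Definition _ := GRing.Zmodule.copy P {poly D}.

Definition twisted_mul (p q : P) : P :=
  \poly_(i < (size (p : {poly D}) + size (q : {poly D})).-1)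
    (\sum_(j < i.+1) (p : {poly D})`_j * iter j rho (q : {poly D})`_(i - j)).

Let rho_iterD n : {morph iter n rho : x y / x + y}.
Proof. by move=> x y; elim: n => //= n ->; rewrite rmorphD. Qed.

Let rho_iterM n : {morph iter n rho : x y / x * y}.
Proof. by move=> x y; elim: n => //= n ->; rewrite rmorphM. Qed.

Let rho_iter0 n : iter n rho 0 = 0.
Proof. by elim: n => //= n ->; rewrite rmorph0. Qed.

Let rho_iter1 n : iter n rho 1 = 1.
Proof. by elim: n => //= n ->; rewrite rmorph1. Qed.

Lemma coef_twisted_mul (p q : {poly D}) i :
  (twisted_mul p q : {poly D})`_i = \sum_(j < i.+1) p`_j * iter j rho q`_(i - j).
Proof.
rewrite coef_poly ltn_predRL; case: leqP => // le_pq_i1.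
rewrite big1 // => j _; have [lq_p_j|lt_j_p] := leqP (size p) j.
  by rewrite nth_default ?mul0r.
rewrite [q`__]nth_default ?rho_iter0 ?mulr0 // leq_subRL -ltnS //.
by rewrite (leq_trans _ le_pq_i1) // ltn_add2r.
Qed.

Let coef_twisted_mul_rev (p q : {poly D}) i :
  (twisted_mul p q : {poly D})`_i =
  \sum_(j < i.+1) p`_(i - j) * iter (i - j) rho q`_j.
Proof.
rewrite coef_twisted_mul (reindex_inj rev_ord_inj) /=.
by apply: eq_bigr => j _; rewrite (sub_ordK j).
Qed.

Fact twisted_mulA : associative twisted_mul.
Proof.
move=> p q s; apply/polyP=> i; rewrite coef_twisted_mul coef_twisted_mul_rev.
pose coef3 j l := (p : {poly D})`_j *
  iter j rho ((q : {poly D})`_(i - j - l) * iter (i - j - l) rho (s : {poly D})`_l).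
transitivity (\sum_(j < i.+1) \sum_(l < i.+1 | (l <= i - j)%N) coef3 j l).
  apply: eq_bigr => /= j _; rewrite coef_twisted_mul_rev (big_morph _ (rho_iterD j) (rho_iter0 j)).
  by rewrite big_distrr /= (big_ord_narrow_leq (leq_subr _ _)).
rewrite (exchange_big_dep predT) //=; apply: eq_bigr => l _.
transitivity (\sum_(j < i.+1 | (j <= i - l)%N) coef3 j l).
  apply: eq_bigl => j; rewrite -ltnS -(ltnS j) -!subSn ?leq_ord //.
  by rewrite -subn_gt0 -(subn_gt0 j) -!subnDA addnC.
rewrite (big_ord_narrow_leq (leq_subr _ _)) coef_twisted_mul big_distrl /=.
apply: eq_bigr => j _; rewrite /coef3 rho_iterM mulrA -ssrnat.iterD -!subnDA addnC.
by rewrite subnDA subnKC // -ltnS.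
Qed.

Fact twisted_1mul : left_id (1%:P : {poly D}) twisted_mul.
Proof.
move=> p; apply/polyP => i; rewrite coef_twisted_mul big_ord_recl subn0 big1.
  by rewrite coefC /= mul1r addr0.
by move=> j _; rewrite coefC mul0r.
Qed.

Fact twisted_mul1 : right_id (1%:P : {poly D}) twisted_mul.
Proof.
move=> p; apply/polyP => i; rewrite coef_twisted_mul_rev big_ord_recl subn0 big1.
  by rewrite coefC /= rho_iter1 mulr1 addr0.
by move=> j _; rewrite coefC rho_iter0 mulr0.
Qed.

Fact twisted_mulDl : left_distributive twisted_mul +%R.
Proof.
move=> p q s; apply/polyP=> i; rewrite coefD !coef_twisted_mul -big_split.
by apply: eq_bigr => j _; rewrite coefD mulrDl.
Qed.

Fact twisted_mulDr : right_distributive twisted_mul +%R.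
Proof.
move=> p q s; apply/polyP=> i; rewrite coefD !coef_twisted_mul -big_split.
by apply: eq_bigr => j _; rewrite coefD rho_iterD mulrDr.
Qed.

Fact twisted_1neq0 : (1%:P : {poly D}) != (0 : P).
Proof. exact: poly1_neq0. Qed.

HB.instance Definition _ :=
  GRing.Zmodule_isNzRing.Build P twisted_mulA twisted_1mul
    twisted_mul1 twisted_mulDl twisted_mulDr twisted_1neq0.

Definition twistedC (a : D) : P := a%:P.
Definition twistedX : P := 'X.

Lemma twistedXC a : twistedX * twistedC a = twistedC (rho a) * twistedX.
Proof.
apply/polyP=> i; rewrite !coef_twisted_mul [RHS]big_ord_recl /= subn0.
rewrite [in RHS]big1 => [|j _]; last by rewrite coefC mul0r.
rewrite addr0 big_ord_recl coefX mul0r add0r coefC coefX /=.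
case: i => [|i]; first by rewrite big_ord0 mulr0.
rewrite big_ord_recl coefX mul1r big1 => [|j _]; last by rewrite coefX mul0r.
by rewrite coefC addr0 /= subn1; case: i => [|i] /=; rewrite ?rmorph0 ?mulr0 ?mulr1.
Qed.

Definition twisted_irreducible (f : P) : Prop :=
  ~ (exists g : P, f * g = 1 /\ g * f = 1) /\
  ~ (exists g h : P,
       [/\ (size (g : {poly D}) < size (f : {poly D}))%N,
           (size (h : {poly D}) < size (f : {poly D}))%N & f = g * h]).

End TwistedPolynomial.

Arguments twistedX {D} rho.
Arguments twistedC {D} rho a.

Section Composite.
Variables (F0 : fieldType) (L F : fieldExtType F0) (K : fieldExtType F).
Variable iota : L -> K.

Definition linearly_disjoint : Prop :=
  forall X : seq L, free X -> free [seq iota x | x <- X].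

(* Elements of {subfield K} are the subfields of K containing F. *)
Definition is_composite : Prop :=
  forall U : {subfield K}, (forall x : L, iota x \in U) -> U = {:K}%AS.

End Composite.

Definition tau_tilde (F : fieldType) (K : splittingFieldType F)
    (sigma : gal_of {:K}) (a : K) (tau : K -> K)
    (u : cyclic_algebra sigma a) : cyclic_algebra sigma a :=
  [ffun i => tau (u i)].

Lemma tau_tilde_mul (F : fieldType) (K : splittingFieldType F)
    (sigma : gal_of {:K}) (a : K) (tau : {rmorphism K -> K}) :
  (forall x, tau (sigma x) = sigma (tau x)) -> tau a = a ->
  {morph tau_tilde (sigma := sigma) (a := a) tau : u v / cyclic_mul u v}.
Proof.
move=> tau_sigma tau_a u v.
have tauX j x : tau ((sigma ^+ j)%g x) = (sigma ^+ j)%g (tau x).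
  elim: j => [|j IHj]; first by rewrite expg0 !gal_id.
  by rewrite expgSr !galM ?memvf // tau_sigma IHj.
apply/ffunP=> l; rewrite ffunE sum_ffunE rmorph_sum sum_ffunE.
apply: eq_bigr => i _; rewrite !sum_ffunE rmorph_sum; apply: eq_bigr => j _ /=.
by case: ifP => _; rewrite !ffunE; case: ifP; rewrite ?rmorph0 // !rmorphM /= tauX ?tau_a.
Qed.

(* Main.v *)
Require Import Defs.
From HB Require Import structures.
From mathcomp Require Import all_boot all_order all_algebra all_fingroup.
From mathcomp Require Import all_solvable all_field.
From mathcomp Require Import zify.

Set Implicit Arguments.
Unset Strict Implicit.
Unset Printing Implicit Defensive.

Import GRing.Theory.
Local Open Scope ring_scope.

(** Write R = D[t; rho], with rho the inverse of tau_tilde, and f = t^m - d.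
The tensor product T is the algebra that Petit attaches to f: polynomials of
degree less than m, multiplied in R and reduced modulo the left ideal R f.
Indeed x t = t tau_tilde(x) in R, so that t obeys the rule defining the
generator e of (F/F_0, tau, d), and (t^k z) t^m = t^k t^m z is congruent to
t^k z d modulo R f, which is the rule e^m = d.  Hence
    a (x) (sum_j e^j y_j)  |->  a (sum_j t^j y_j)
is multiplicative modulo R f ([tensor_polyM]): the images of the two factors
commute, and the failure of associativity of the second factor is absorbed by
the reduction, because R f is only a left ideal.  A basis of L over F_0
remains a basis of K over F ([composite_basisP]), so this map is a bijection
from T onto the polynomials of degree less than m
([tensor_poly_inj], [tensor_poly_surj]).

It remains to compare zero divisors ([petit_division_irreducible]); by
finiteness of the dimension, T is a division algebra as soon as it has none.
A factorization f = g h into factors of smaller degree gives two nonzero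
elements of T with product zero.  Conversely, suppose that g h = q f with g and
h nonzero of degree less than m.  Since D is a division ring, R has a Euclidean
right division.  Running Euclid's algorithm on (f, h) preserves a relation of
the shape g h = q f, and comparing degrees along the way yields a common right
divisor p of f and h with deg f <= deg g + deg p
([twisted_common_divisor]).  As deg g < deg f, p is not constant; as p divides
h, deg p < deg f; hence p is a proper right factor of f, which is therefore
reducible. *)

(** * Coefficients of twisted polynomials *)

Section TwistedCoefficients.
Variables (D : nzRingType) (rho : {rmorphism D -> D}).
Local Notation P := (twisted_poly rho).
Local Notation C := (twistedC rho).
Local Notation t := (twistedX rho).

Lemma coef_twistedCM a (p : P) i :
  (C a * p : {poly D})`_i = a * (p : {poly D})`_i.
Proof.
rewrite coef_twisted_mul big_ord_recl subn0 coefC /= big1 ?addr0 // => j _.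
by rewrite coefC mul0r.
Qed.

Lemma coef_twistedXM (p : P) i :
  (t * p : {poly D})`_i = if i is i'.+1 then rho (p : {poly D})`_i' else 0.
Proof.
rewrite coef_twisted_mul big_ord_recl coefX mul0r add0r.
case: i => [|i]; first by rewrite big_ord0.
rewrite big_ord_recl coefX mul1r big1 => [|j _]; last by rewrite coefX mul0r.
by rewrite addr0 /= subn1.
Qed.

Lemma coef_twistedXnM (p : P) k i :
  (t ^+ k * p : {poly D})`_i =
  if (i < k)%N then 0 else iter k rho (p : {poly D})`_(i - k).
Proof.
elim: k i => [|k IHk] i; first by rewrite expr0 mul1r subn0.
rewrite exprS -mulrA coef_twistedXM; case: i => [|i] //=.
by rewrite IHk ltnS subSS; case: ifP; rewrite ?rmorph0.
Qed.

Lemma coef_twistedXn k i : (t ^+ k : {poly D})`_i = (i == k)%:R.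
Proof.
have iter_rho (b : bool) j : iter j rho b%:R = b%:R.
  by elim: j => //= j ->; rewrite rmorph_nat.
rewrite -[t ^+ k]mulr1 coef_twistedXnM coefC -/(nat_of_bool _).
case: ltngtP => [//|ik|->]; last by rewrite subnn /= (iter_rho true).
by rewrite subn_eq0 leqNgt ik /= (iter_rho false).
Qed.

Lemma coef_twisted_sum n (a : 'I_n -> D) j :
  (\sum_(i < n) C (a i) * t ^+ i : {poly D})`_j = if insub j is Some i then a i else 0.
Proof.
rewrite coef_sum; case: insubP => [i _ <-|].
  rewrite (bigD1 i) //= coef_twistedCM coef_twistedXn eqxx mulr1 big1 ?addr0 //.
  move=> l nl; rewrite coef_twistedCM coef_twistedXn.
  case: eqP => [el|_]; last by rewrite mulr0.
  by case/eqP: nl; apply: val_inj.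
rewrite -leqNgt => le_j; rewrite big1 // => i _; rewrite coef_twistedCM coef_twistedXn.
case: eqP => [e|_]; last by rewrite mulr0.
by move: le_j; rewrite e leqNgt ltn_ord.
Qed.

Lemma size_twistedD_le n (p q : P) :
  (size (p : {poly D}) <= n)%N -> (size (q : {poly D}) <= n)%N ->
  (size (p + q)%R <= n)%N.
Proof. by move=> sp sq; rewrite (leq_trans (size_polyD _ _)) // geq_max sp. Qed.

Lemma twistedC_is_zmod_morphism : zmod_morphism C.
Proof. by move=> a b; apply: polyCB. Qed.

Lemma twistedC_is_monoid_morphism : monoid_morphism C.
Proof.
split=> // a b; apply/polyP=> i; rewrite coef_twistedCM !coefC.
by case: eqP; rewrite ?mulr0.
Qed.

HB.instance Definition _ := GRing.isZmodMorphism.Build D P C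
  twistedC_is_zmod_morphism.
HB.instance Definition _ := GRing.isMonoidMorphism.Build D P C
  twistedC_is_monoid_morphism.

End TwistedCoefficients.

(** * Right division in twisted polynomial rings *)

Section TwistedEuclid.
Variables (D : nzRingType) (rho : {rmorphism D -> D}).
Hypothesis divD : forall a : D, a != 0 -> exists b, b * a = 1.
Local Notation P := (twisted_poly rho).
Local Notation C := (twistedC rho).
Local Notation t := (twistedX rho).
Local Notation sz p := (size (p%R : {poly D})).

Lemma left_inverse_mulf_neq0 (a b : D) : a != 0 -> b != 0 -> a * b != 0.
Proof.
move=> /divD[a' a'a] b0; apply: contraNneq b0 => ab0.
by rewrite -[b]mul1r -a'a -mulrA ab0 mulr0.
Qed.

Lemma iter_rho0 k : iter k rho 0 = 0.
Proof. by elim: k => //= k ->; rewrite rmorph0. Qed.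

Lemma iter_rho_neq0 k (a : D) : a != 0 -> iter k rho a != 0.
Proof.
move=> a0; elim: k => //= k /divD[b ba].
apply/eqP=> /(congr1 (fun x => rho b * x)).
by rewrite -rmorphM ba rmorph1 mulr0 => /eqP; rewrite oner_eq0.
Qed.

(** Left inverses for the nonzero elements of D suffice: they exclude zero
divisors in D and make rho injective, so leading terms do not cancel. *)
Lemma size_twistedM (p q : P) : p != 0 -> q != 0 ->
  sz (p * q) = (sz p + sz q).-1.
Proof.
move=> p0 q0; have sp : (0 < sz p)%N by rewrite size_poly_gt0.
have sq : (0 < sz q)%N by rewrite size_poly_gt0.
have lastj : ((sz p).-1 < (sz p + sz q).-2.+1)%N.
  by rewrite -(prednK sp) -(prednK sq) addnS /= ltnS leq_addr.
have top : \sum_(j < (sz p + sz q).-2.+1) (p : {poly D})`_j *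
    iter j rho (q : {poly D})`_((sz p + sz q).-2 - j) != 0.
  rewrite (bigD1 (Ordinal lastj)) //= big1 ?addr0 => [|j nj].
    rewrite left_inverse_mulf_neq0 ?lead_coef_eq0 ?iter_rho_neq0 //.
    suff -> : ((sz p + sz q).-2 - (sz p).-1 = (sz q).-1)%N by rewrite lead_coef_eq0.
    by rewrite -(prednK sp) -(prednK sq) addSn addnS /= addKn.
  have [lt_j|gt_j|ej] := ltngtP j (sz p).-1; last first.
  - by case/eqP: nj; apply: val_inj.
  - by rewrite nth_default ?mul0r //; apply: leq_trans gt_j; rewrite prednK.
  rewrite [(q : {poly D})`__]nth_default.
    by rewrite iter_rho0 mulr0.
  have bound a b i : (i < a.-1 -> 0 < b -> b <= (a + b).-2 - i)%N by lia.
  exact: bound.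
by rewrite /GRing.mul /= /twisted_mul size_poly_eq.
Qed.

Lemma twisted_mulf_neq0 (p q : P) : p != 0 -> q != 0 -> p * q != 0.
Proof.
move=> p0 q0; rewrite -size_poly_gt0 size_twistedM //.
by move: p0 q0; rewrite -!size_poly_gt0; case: (sz p) (sz q) => // ? [|?] //; rewrite addnS.
Qed.

(** Each step cancels the leading term a t^(k + l) of p against that of g, of
degree l: from b rho^k(lead_coef g) = 1 follows that a b t^k g has the same
leading term as p. *)
Lemma twisted_divp (p g : P) : g != 0 ->
  exists q r : P, p = q * g + r /\ (sz r < sz g)%N.
Proof.
move=> g0; have sg : (0 < sz g)%N by rewrite size_poly_gt0.
have [s] := ubnP (sz p); elim: s p => // s IHs p; rewrite ltnS => sp.
have [lt_pg|le_gp] := ltnP (sz p) (sz g).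
  by exists 0, p; rewrite mul0r add0r.
pose k := (sz p - sz g)%N.
have lead_g0 : lead_coef (g : {poly D}) != 0 by rewrite lead_coef_eq0.
have [b b_lead] := divD (iter_rho_neq0 k lead_g0).
pose u : P := C (lead_coef (p : {poly D}) * b) * t ^+ k.
have sp0 : (0 < sz p)%N by apply: leq_trans le_gp.
have degree_bound a c i : (0 < c -> c <= a -> a.-1 <= i -> a - c <= i)%N by lia.
have degree_top a c : (0 < c -> c <= a -> a.-1 - (a - c) = c.-1)%N by lia.
have degree_above a c i : (0 < c -> c <= a -> a.-1 < i -> c <= i - (a - c))%N by lia.
have szp' : (sz (p - u * g) < s)%N.
  apply: leq_trans sp; rewrite -[X in (_ < X)%N](prednK sp0) ltnS.
  apply/leq_sizeP=> i le_i.
  rewrite coefB -mulrA coef_twistedCM coef_twistedXnM ltnNge degree_bound //=.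
  move: le_i; rewrite leq_eqVlt => /predU1P[<-|lt_i].
    by rewrite /k degree_top // -mulrA b_lead mulr1 subrr.
  rewrite nth_default; last by rewrite -(prednK sp0).
  by rewrite nth_default ?degree_above // iter_rho0 mulr0 subr0.
have [q [r [def_p' lt_r]]] := IHs _ szp'.
by exists (u + q), r; split=> //; rewrite mulrDl -addrA -def_p' addrC subrK.
Qed.

(** The bound on deg f stands in for the equality of deg f + deg h with the sum
of the degrees of the least common left multiple and of the greatest common
right divisor.  It is proved along Euclid's algorithm for (f, h): if
f = v h + r, the relation g h = q f becomes q r = (g - q v) h, of the same
shape for the pair (h, r), with q in the part of g.  The bound
deg h <= deg q + deg p obtained for that pair is the one wanted, because
deg g + deg h = deg q + deg f. *)
Lemma twisted_common_divisor (f g h q : P) : f != 0 -> g != 0 -> g * h = q * f ->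
  exists p f' h' : P, [/\ f = f' * p, h = h' * p & (sz f < sz g + sz p)%N].
Proof.
have [s] := ubnP (sz h); elim: s f g h q => // s IHs f g h q; rewrite ltnS => sh f0 g0 gh.
have [->|h0] := eqVneq h 0.
  exists f, 1, 0; rewrite mul1r mul0r; split=> //.
  by rewrite -[X in (X < _)%N]add0n ltn_add2r size_poly_gt0.
have q0 : q != 0.
  by apply: contraTneq (twisted_mulf_neq0 g0 h0) => q0; rewrite gh q0 mul0r eqxx.
have [v [r [def_f lt_r]]] := twisted_divp f h0.
have qr : q * r = (g - q * v) * h.
  by rewrite mulrBl gh def_f mulrDr mulrA [_ + q * r]addrC addrK.
have [|p [h' [r' [def_h def_r lt_h]]]] := IHs h q r (g - q * v) _ h0 q0 qr.
  exact: leq_trans lt_r sh.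
exists p, (v * h' + r'), h'; split=> //.
  by rewrite mulrDl -mulrA -def_h -def_r.
have := congr1 (fun x : P => sz x) gh; rewrite /= !size_twistedM // => eq_sz.
move: g0 q0 h0 f0; rewrite -!size_poly_gt0 => g0 q0 h0 f0.
rewrite -(ltn_add2l (sz q)) -(prednK (_ : 0 < sz q + sz f)%N) ?addn_gt0 ?q0 // -eq_sz.
by rewrite prednK ?addn_gt0 ?g0 // addnCA ltn_add2l.
Qed.

(** The common right divisor p of f and h is a proper factor of f: it is not
constant because deg g < deg f, and deg p <= deg h < deg f. *)
Lemma twisted_irreducible_zero_divisor (f g h q : P) : twisted_irreducible f ->
  g * h = q * f -> (sz g < sz f)%N -> (sz h < sz f)%N -> g = 0 \/ h = 0.
Proof.
move=> [_ irr_f] gh lt_g lt_h.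
have [->|g0] := eqVneq g 0; first by left.
have [->|h0] := eqVneq h 0; first by right.
have f0 : f != 0 by rewrite -size_poly_gt0 (leq_ltn_trans _ lt_g).
have [p [f' [h' [def_f def_h lt_f]]]] := twisted_common_divisor f0 g0 gh.
have p0 : p != 0 by apply: contraNneq f0 => p0; rewrite def_f p0 mulr0.
have f'0 : f' != 0 by apply: contraNneq f0 => f'0; rewrite def_f f'0 mul0r.
have h'0 : h' != 0 by apply: contraNneq h0 => h'0; rewrite def_h h'0 mul0r.
case: irr_f; exists f', p; split=> //.
  have szf : sz f = (sz f' + sz p).-1 by rewrite def_f size_twistedM.
  have bound a b c e : (a = (b + c).-1 -> e < a -> a < e + c -> b < a)%N by lia.
  exact: bound szf lt_g lt_f.
apply: leq_ltn_trans lt_h; rewrite def_h size_twistedM //.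
by move: h'0; rewrite -size_poly_gt0; case: (sz h') => // j _; rewrite addSn leq_addl.
Qed.

End TwistedEuclid.

(** * Division algebras and zero divisors *)

Section NoZeroDivisors.
Variables (k : fieldType) (A : nonassocAlgType k).

Lemma namulr0 (a : A) : namul a 0 = 0.
Proof. by rewrite -(scale0r (0 : A)) namulZr !scale0r. Qed.

Lemma namul0r (a : A) : namul 0 a = 0.
Proof. by rewrite -(scale0r (0 : A)) namulZl !scale0r. Qed.

Lemma linear_ker0_bijective (V : vectType k) (f : {linear V -> V}) :
  (forall x, f x = 0 -> x = 0) -> bijective f.
Proof.
move=> ker_f; have ker0 : lker (linfun f) == 0%VS.
  rewrite -subv0; apply/subvP=> x; rewrite memv_ker lfunE => /eqP/ker_f ->.
  exact: mem0v.
exists (linfun f)^-1%VF => x.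
  by have := lker0_lfunK ker0 x; rewrite lfunE.
by have := lker0_lfunVK ker0 x; rewrite lfunE.
Qed.

(** One-sided multiplications are linear, so they are bijective as soon as
their kernel is trivial. *)
Lemma division_algebra_no_zero_divisor : is_division_algebra A <->
  (exists a : A, a != 0) /\ (forall a b : A, namul a b = 0 -> a = 0 \/ b = 0).
Proof.
split=> [[nz divA]|[nz noZD]]; split=> // a.
  move=> b ab0; have [->|a0] := eqVneq a 0; [by left | right].
  by have [/bij_inj inj_a _] := divA a a0; apply: inj_a; rewrite ab0 namulr0.
move=> a0.
have lin_l : linear (fun x : A => namul a x).
  by move=> s x y; rewrite namulDr namulZr.
have lin_r : linear (fun x : A => namul x a).
  by move=> s x y; rewrite namulDl namulZl.
pose Ll := GRing.isLinear.Build k A A *:%R _ lin_l.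
pose Lr := GRing.isLinear.Build k A A *:%R _ lin_r.
pose fl : {linear A -> A} := HB.pack (fun x : A => namul a x) Ll.
pose fr : {linear A -> A} := HB.pack (fun x : A => namul x a) Lr.
split; [apply: (@linear_ker0_bijective A fl) | apply: (@linear_ker0_bijective A fr)].
  by move=> x /noZD[a_eq0|//]; rewrite a_eq0 eqxx in a0.
by move=> x /noZD[//|a_eq0]; rewrite a_eq0 eqxx in a0.
Qed.

End NoZeroDivisors.

(** * Congruence modulo a principal left ideal *)

Section CongruenceModLeftIdeal.
Variables (R : nzRingType) (f : R).

Definition congr_modl (p q : R) := exists r, p = q + r * f.

Lemma congr_modl_refl p : congr_modl p p.
Proof. by exists 0; rewrite mul0r addr0. Qed.

Lemma congr_modlD p1 p2 q1 q2 :
  congr_modl p1 q1 -> congr_modl p2 q2 -> congr_modl (p1 + p2) (q1 + q2).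
Proof. by move=> [r1 ->] [r2 ->]; exists (r1 + r2); rewrite mulrDl addrACA. Qed.

Lemma congr_modlM p q s : congr_modl p q -> congr_modl (s * p) (s * q).
Proof. by move=> [r ->]; exists (s * r); rewrite mulrDr mulrA. Qed.

End CongruenceModLeftIdeal.

(** * Maps out of a tensor product *)

Section TensorUniversal.
Variables (k : fieldType) (A B : nonassocAlgType k).
Local Notation T := (tensor A B).

Lemma tens0l (b : B) : tens (0 : A) b = 0.
Proof. by apply/matrixP=> i j; rewrite !mxE linear0 mul0r. Qed.

Lemma tens0r (a : A) : tens a (0 : B) = 0.
Proof. by apply/matrixP=> i j; rewrite !mxE linear0 mulr0. Qed.

Lemma tensor_ind (Q : T -> Prop) : Q 0 -> (forall u v, Q u -> Q v -> Q (u + v)) ->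
  (forall a b, Q (tens a b)) -> forall u, Q u.
Proof.
move=> Q0 QD Qtens u; rewrite (tensor_decomp u).
apply: (big_ind Q) => // i _; apply: (big_ind Q) => // j _.
by rewrite -tensZl.
Qed.

Variables (V : zmodType) (h : A -> B -> V).
Hypotheses (hDl : forall b, {morph h^~ b : a a' / a + a'})
           (hDr : forall a, {morph h a : b b' / b + b'})
           (hZ : forall s a b, h (s *: a) b = h a (s *: b)).

(** The universal property of the tensor product, for a balanced biadditive map
h.  The scalar u i j is absorbed by the left argument of h, so that V only has
to be an additive group. *)
Definition tensor_lift (u : T) : V :=
  \sum_i \sum_j h (u i j *: (vbasis {:A})`_i) (vbasis {:B})`_j.

Lemma tensor_lift_closed (Q : V -> Prop) : Q 0 -> (forall x y, Q x -> Q y -> Q (x + y)) ->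
  (forall a b, Q (h a b)) -> forall u, Q (tensor_lift u).
Proof.
move=> Q0 QD Qh u; apply: (big_ind Q) => // i _.
by apply: (big_ind Q) => // j _.
Qed.

Lemma tensor_liftD : {morph tensor_lift : u v / u + v}.
Proof.
move=> u v; rewrite /tensor_lift -big_split; apply: eq_bigr => i _.
rewrite -big_split; apply: eq_bigr => j _.
by rewrite mxE scalerDl hDl.
Qed.

Lemma tensor_lift_tens a b : tensor_lift (tens a b) = h a b.
Proof.
have h0l y : h 0 y = 0 by apply: (addrI (h 0 y)); rewrite -hDl !addr0.
have h0r x : h x 0 = 0 by apply: (addrI (h x 0)); rewrite -hDr !addr0.
rewrite {2}(coord_vbasis (memvf a)) (big_morph (h^~ b) (hDl b) (h0l b)).
apply: eq_bigr => i _; rewrite {2}(coord_vbasis (memvf b)).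
rewrite (big_morph _ (hDr _) (h0r _)); apply: eq_bigr => j _.
by rewrite mxE mulrC -scalerA hZ.
Qed.

End TensorUniversal.

Section TensorLiftModulo.
Variables (k : fieldType) (A B : nonassocAlgType k) (R : nzRingType) (f : R).
Variables (alpha : A -> R) (beta : B -> R).
Hypotheses (alphaD : {morph alpha : a a' / a + a'})
           (betaD : {morph beta : b b' / b + b'})
           (balanced : forall s a b, alpha (s *: a) * beta b = alpha a * beta (s *: b))
           (alphaM : forall a a', alpha (namul a a') = alpha a * alpha a')
           (betaM : forall b b', congr_modl f (beta b * beta b') (beta (namul b b')))
           (alpha_beta : forall a b, alpha a * beta b = beta b * alpha a).
Local Notation lift := (tensor_lift (fun (a : A) (b : B) => alpha a * beta b)).

Lemma tensor_lift_mul_additive : {morph lift : u v / u + v}.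
Proof. by apply: tensor_liftD => b a a'; rewrite alphaD mulrDl. Qed.

Lemma tensor_lift_mul_tens a b : lift (tens a b) = alpha a * beta b.
Proof.
by apply: tensor_lift_tens => [b' a1 a2|a' b1 b2|//]; rewrite ?alphaD ?betaD ?mulrDl ?mulrDr.
Qed.

(** A left ideal is enough here: as alpha a' commutes with beta b, the error
term of beta b * beta b' ends up multiplied on the left by
alpha a * alpha a'. *)
Lemma tensor_lift_mul_modl (u v : tensor A B) :
  congr_modl f (lift u * lift v) (lift (namul u v)).
Proof.
have lift0 : lift 0 = 0 by apply: (addrI (lift 0)); rewrite -tensor_lift_mul_additive !addr0.
elim/tensor_ind: u => [|u1 u2 IH1 IH2|a b].
- by rewrite namul0r lift0 mul0r; apply: congr_modl_refl.
- by rewrite namulDl !tensor_lift_mul_additive mulrDl; apply: congr_modlD.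
elim/tensor_ind: v => [|v1 v2 IH1 IH2|a' b'].
- by rewrite namulr0 lift0 mulr0; apply: congr_modl_refl.
- by rewrite namulDr !tensor_lift_mul_additive mulrDr; apply: congr_modlD.
rewrite [namul _ _]tensor_mul_tens !tensor_lift_mul_tens alphaM.
rewrite -[_ * (alpha a' * _)]mulrA (mulrA (beta b)) -alpha_beta -(mulrA (alpha a')).
rewrite (mulrA (alpha a)); exact: congr_modlM.
Qed.

End TensorLiftModulo.

(** * Cyclic algebras modulo t^r - a *)

Section CyclicInduction.
Variables (k : fieldType) (E : splittingFieldType k) (rho : gal_of {:E}) (a : E).

Lemma cyclic_ind (Q : cyclic_algebra rho a -> Prop) :
  Q 0 -> (forall u v, Q u -> Q v -> Q (u + v)) ->
  (forall i x, (i < #[rho]%g)%N -> Q (cyclic_mono rho a i x)) -> forall u, Q u.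
Proof.
move=> Q0 QD Qmono u; rewrite (cyclic_decomp u).
by apply: (big_ind Q) => // i _; apply: Qmono.
Qed.

Lemma cyclic_coef0 l : (0 : cyclic_algebra rho a) l = 0.
Proof. exact: ffunE. Qed.

Lemma cyclic_coef_sum n (z : nat -> E) (l : 'I_#[rho]%g) : (l < n)%N ->
  (\sum_(i < n) cyclic_mono rho a i (z i)) l = z l.
Proof.
move=> ltl; rewrite sum_ffunE (bigD1 (Ordinal ltl)) //= ffunE eqxx big1 ?addr0 //.
move=> i ni; rewrite ffunE; case: eqP => // e.
by case/eqP: ni; apply: val_inj.
Qed.

(** The order of rho may be replaced by any equal number n, which a sum over the
index type of the coefficients would not allow. *)
Lemma cyclic_decomp_nat n (u : cyclic_algebra rho a) : n = #[rho]%g ->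
  u = \sum_(i < n) cyclic_mono rho a i (if insub (i : nat) is Some l then u l else 0).
Proof.
by move=> ->; rewrite {1}(cyclic_decomp u); apply: eq_bigr => i _; rewrite valK.
Qed.

End CyclicInduction.

Lemma cyclic_mulE (k : fieldType) (E : splittingFieldType k) (rho : gal_of {:E})
  (c : k) (u v : cyclic_algebra rho (c%:A : E)) : u * v = cyclic_mul u v.
Proof. by []. Qed.

Section CyclicLift.
Variables (k : fieldType) (E : splittingFieldType k) (rho : gal_of {:E}) (a : E).
Variables (R : nzRingType) (g : {rmorphism E -> R}) (t : R).
Hypothesis g_t : forall x, g x * t = t * g (rho x).
Local Notation A := (cyclic_algebra rho a).
Local Notation r := #[rho]%g.

Definition cyclic_lift (u : A) : R := \sum_(j < r) t ^+ j * g (u j).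

Lemma cyclic_liftD : {morph cyclic_lift : u v / u + v}.
Proof.
move=> u v; rewrite /cyclic_lift -big_split; apply: eq_bigr => i _.
by rewrite ffunE rmorphD mulrDr.
Qed.

Lemma cyclic_lift0 : cyclic_lift 0 = 0.
Proof. by apply: (addrI (cyclic_lift 0)); rewrite -cyclic_liftD !addr0. Qed.

Lemma cyclic_lift_mono j y : (j < r)%N ->
  cyclic_lift (cyclic_mono rho a j y) = t ^+ j * g y.
Proof.
move=> ltj; rewrite /cyclic_lift (bigD1 (Ordinal ltj)) //= big1 ?addr0 ?ffunE ?eqxx //.
move=> i ni; rewrite ffunE; case: eqP => [ei|_]; last by rewrite rmorph0 mulr0.
by case/eqP: ni; apply: val_inj.
Qed.

Lemma cyclic_lift_X j y : g y * t ^+ j = t ^+ j * g ((rho ^+ j)%g y).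
Proof.
elim: j y => [|j IHj] y; first by rewrite expr0 expg0 gal_id mul1r mulr1.
by rewrite exprS mulrA g_t -mulrA IHj mulrA expgS galM ?memvf.
Qed.

Lemma cyclic_lift_coefl u :
  cyclic_lift u = \sum_(j < r) g (((rho ^+ j)^-1)%g (u j)) * t ^+ j.
Proof.
apply: eq_bigr => j _; rewrite cyclic_lift_X -galM ?memvf //.
by rewrite mulVg gal_id.
Qed.

Lemma cyclic_liftZ s u : cyclic_lift (s *: u) = g s%:A * cyclic_lift u.
Proof.
rewrite /cyclic_lift mulr_sumr; apply: eq_bigr => j _; rewrite ffunE mulrA.
by rewrite cyclic_lift_X -mulrA -rmorphM linearZ /= rmorph1 mulr_algl.
Qed.

Lemma cyclic_lift_comm z u : z * t = t * z -> (forall y, z * g y = g y * z) ->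
  z * cyclic_lift u = cyclic_lift u * z.
Proof.
move=> zt zg; rewrite /cyclic_lift mulr_sumr mulr_suml; apply: eq_bigr => j _.
by rewrite mulrA (commrX j zt) -!mulrA zg.
Qed.

(** When the product of e^i x and e^j y wraps around, w = rho^j(x) y and
l = i + j - r, and t^(i + j) w = t^l t^r w = t^l w t^r, since rho^r = 1; the
latter is congruent to t^l w a. *)
Lemma cyclic_liftM u v :
  congr_modl (t ^+ r - g a) (cyclic_lift u * cyclic_lift v) (cyclic_lift (cyclic_mul u v)).
Proof.
elim/cyclic_ind: u => [|u1 u2 IH1 IH2|i x lti].
- by rewrite cyclic_mul0l cyclic_lift0 mul0r; apply: congr_modl_refl.
- by rewrite cyclic_mulDl !cyclic_liftD mulrDl; apply: congr_modlD.
elim/cyclic_ind: v => [|v1 v2 IH1 IH2|j y ltj].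
- by rewrite cyclic_mul0r cyclic_lift0 mulr0; apply: congr_modl_refl.
- by rewrite cyclic_mulDr !cyclic_liftD mulrDr; apply: congr_modlD.
rewrite cyclic_mono_mul // !cyclic_lift_mono // -mulrA (mulrA (g x)).
rewrite cyclic_lift_X -mulrA -rmorphM mulrA -exprD.
case: ifP => [lt_ij|/negbT]; first by rewrite cyclic_lift_mono //; apply: congr_modl_refl.
rewrite -leqNgt => ge_ij; rewrite cyclic_lift_mono; last by move: lti ltj ge_ij; lia.
set w := _ * y; set l := (_ - _)%N.
have Xr_w : g w * t ^+ r = t ^+ r * g w by rewrite cyclic_lift_X expg_order gal_id.
exists (t ^+ l * g w).
rewrite -[t ^+ l * _ * _]mulrA mulrBr Xr_w -rmorphM mulrBr mulrA -exprD subnK //.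
by rewrite -(mulrA a) [a * _]mulrC addrC subrK.
Qed.

End CyclicLift.

(** * The composite field *)

Section Composite.
Variables (F0 : fieldType) (L F : splittingFieldType F0) (K : splittingFieldType F).
Variable iota : {rmorphism L -> K}.
Hypothesis iota_F0 : forall x : F0, iota x%:A = x%:A%:A.
Hypotheses (disjLF : linearly_disjoint iota) (compLF : is_composite iota).

Lemma composite_iotaZ s x : iota (s *: x) = s%:A *: iota x.
Proof. by rewrite -[s *: x]mulr_algl rmorphM /= iota_F0 mulr_algl. Qed.

Definition composite_basis := map_tuple iota (vbasis {:L}).

(** Linear disjointness gives freeness.  The F-span of the image of a basis of L
is closed under products because L is, hence a subfield containing F and the
image of L; it is all of K because K is the composite. *)
Lemma composite_basisP : basis_of {:K} composite_basis.
Proof.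
have freeX : free composite_basis by apply: disjLF; apply: basis_free (vbasisP _).
have span_iota x : iota x \in <<composite_basis>>%VS.
  rewrite (coord_vbasis (memvf x)) rmorph_sum memv_suml // => i _.
  by rewrite composite_iotaZ memvZ // memv_span // map_f // mem_nth // size_tuple.
have mul_closed : (<<composite_basis>> * <<composite_basis>> <= <<composite_basis>>)%VS.
  apply/prodvP=> y z /coord_span-> /coord_span->.
  rewrite mulr_suml memv_suml // => i _; rewrite mulr_sumr memv_suml // => j _.
  rewrite -scalerAl -scalerAr !memvZ // !(nth_map 0) ?size_tuple //.
  by rewrite -rmorphM.
have alg : is_aspace <<composite_basis>>%VS.
  rewrite /is_aspace mul_closed andbT; apply: has_algid1.
  by rewrite -(rmorph1 iota).
have := compLF (U := ASpace alg) span_iota => /(congr1 (@asval _ _)) /= full.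
by rewrite basisEfree freeX full subvf; rewrite -full (eqP freeX) leqnn.
Qed.

End Composite.

(** * The tensor product as twisted polynomials modulo t^m - d *)

Section Comparison.
Variables (F0 : fieldType) (L F : splittingFieldType F0).
Variables (sigma : gal_of {:L}) (tau : gal_of {:F}).
Variables (K : splittingFieldType F) (iota : {rmorphism L -> K}).
Hypothesis iota_F0 : forall x : F0, iota x%:A = x%:A%:A.
Hypotheses (disjLF : linearly_disjoint iota) (compLF : is_composite iota).
Variables (sigmaK : gal_of {:K}) (tauK : {rmorphism K -> K}).
Hypothesis sigmaK_L : forall x : L, sigmaK (iota x) = iota (sigma x).
Hypothesis tauK_F : forall y : F, tauK y%:A = (tau y)%:A.
Hypothesis tauK_L : forall x : L, tauK (iota x) = iota x.
Variables (d : F) (c : F0).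
Local Notation D0 := (cyclic_algebra sigma (c%:A : L)).
Local Notation B := (cyclic_algebra tau d).
Local Notation D := (cyclic_algebra sigmaK (c%:A%:A : K)).
Local Notation monoD := (cyclic_mono sigmaK (c%:A%:A : K)).
Variable rho : {rmorphism D -> D}.
Hypothesis tau_tildeK : cancel (tau_tilde tauK) rho.
Local Notation R := (twisted_poly rho).
Local Notation C := (twistedC rho).
Local Notation t := (twistedX rho).
Local Notation T := (tensor D0 B).
Local Notation sz p := (size (p%R : {poly D})).
Local Notation X := (vbasis {:L}).
Local Notation iX := (composite_basis iota).

Lemma sigmaK_F j (y : F) : (sigmaK ^+ j)%g y%:A = y%:A.
Proof. by rewrite linearZ /= rmorph1. Qed.

Lemma sigmaKX_L j x : (sigmaK ^+ j)%g (iota x) = iota ((sigma ^+ j)%g x).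
Proof.
elim: j x => [|j IHj] x; first by rewrite !expg0 !gal_id.
by rewrite !expgS !galM ?memvf // sigmaK_L IHj.
Qed.

Lemma composite_coord (z : K) :
  z = \sum_(s < \dim {:L}) coord iX s z *: iota X`_s.
Proof.
rewrite {1}(coord_basis (composite_basisP iota_F0 disjLF compLF) (memvf z)).
by apply: eq_bigr => s _; rewrite (nth_map 0) ?size_tuple.
Qed.

(** The two cyclic algebras thus have as many coefficients: sigmaK is determined
by its values on L, as it fixes F and L spans K over F. *)
Lemma order_sigmaK : #[sigmaK]%g = #[sigma]%g.
Proof.
apply/eqP; rewrite eqn_dvd !order_dvdn; apply/andP; split; apply/gal_eqP=> x _.
  rewrite gal_id (composite_coord x) linear_sum; apply: eq_bigr => s _.
  by rewrite linearZ /= sigmaKX_L expg_order gal_id.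
apply: (fmorph_inj iota).
by rewrite -sigmaKX_L expg_order !gal_id.
Qed.

Definition scal_ext (a : D0) : D := \sum_(i < #[sigma]%g) monoD i (iota (a i)).

Lemma scal_extD : {morph scal_ext : a b / a + b}.
Proof.
move=> a b; rewrite /scal_ext -big_split; apply: eq_bigr => i _.
by rewrite ffunE rmorphD cyclic_monoD.
Qed.

Lemma scal_ext0 : scal_ext 0 = 0.
Proof. by apply: (addrI (scal_ext 0)); rewrite -scal_extD !addr0. Qed.

Lemma scal_ext_mono i x : (i < #[sigma]%g)%N ->
  scal_ext (cyclic_mono sigma c%:A i x) = monoD i (iota x).
Proof.
move=> lti; rewrite /scal_ext (bigD1 (Ordinal lti)) //= big1 ?addr0 ?ffunE ?eqxx //.
move=> j nj; rewrite ffunE; case: eqP => [ej|_]; last by rewrite rmorph0 cyclic_mono0.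
by case/eqP: nj; apply: val_inj.
Qed.

Lemma scal_extM (a b : D0) : scal_ext (a * b) = scal_ext a * scal_ext b.
Proof.
elim/cyclic_ind: a => [|a a' IHa IHa'|i x lti].
- by rewrite mul0r scal_ext0 mul0r.
- by rewrite mulrDl !scal_extD IHa IHa' mulrDl.
elim/cyclic_ind: b => [|b b' IHb IHb'|j y ltj].
- by rewrite mulr0 scal_ext0 mulr0.
- by rewrite mulrDr !scal_extD IHb IHb' mulrDr.
rewrite !scal_ext_mono // !cyclic_mulE !cyclic_mono_mul ?order_sigmaK //.
rewrite sigmaKX_L; case: ifP => [lt_ij|ge_ij]; rewrite scal_ext_mono ?rmorphM ?iota_F0 //.
by move/negbT: ge_ij; rewrite -leqNgt; move: lti ltj; lia.
Qed.

Lemma scal_extZ s (a : D0) : scal_ext (s *: a) = scal_ext a * monoD 0 s%:A%:A.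
Proof.
elim/cyclic_ind: a => [|a a' IHa IHa'|i x lti].
- by rewrite scaler0 scal_ext0 mul0r.
- by rewrite scalerDr !scal_extD IHa IHa' mulrDl.
rewrite -cyclic_monoZ !scal_ext_mono // cyclic_mulE cyclic_mono_mul ?order_gt0 ?order_sigmaK //.
by rewrite addn0 lti expg0 gal_id composite_iotaZ // mulr_algr.
Qed.

Lemma rho_mono i x : rho (monoD i (tauK x)) = monoD i x.
Proof.
rewrite -[RHS]tau_tildeK; congr (rho _); apply/ffunP=> l; rewrite !ffunE.
by case: ifP; rewrite ?rmorph0.
Qed.

Lemma rho_scal_ext a : rho (scal_ext a) = scal_ext a.
Proof.
by rewrite rmorph_sum; apply: eq_bigr => i _; rewrite -{1}tauK_L rho_mono.
Qed.

Definition Fconst (y : F) : R := C (monoD 0 y%:A).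

Lemma Fconst_is_zmod_morphism : zmod_morphism Fconst.
Proof.
by move=> y z; rewrite /Fconst scalerBl -rmorphB; congr C; apply/ffunP=> l;
   rewrite !ffunE; case: ifP; rewrite ?subr0.
Qed.

Lemma Fconst_is_monoid_morphism : monoid_morphism Fconst.
Proof.
split=> [|y z]; first by rewrite /Fconst scale1r -(rmorph1 C).
rewrite /Fconst -rmorphM; congr C; rewrite cyclic_mulE cyclic_mono_mul ?order_gt0 //.
by rewrite expg0 gal_id mulr_algl scalerA.
Qed.

HB.instance Definition _ := GRing.isZmodMorphism.Build F R Fconst
  Fconst_is_zmod_morphism.
HB.instance Definition _ := GRing.isMonoidMorphism.Build F R Fconst
  Fconst_is_monoid_morphism.

Lemma Fconst_X y : Fconst y * t = t * Fconst (tau y).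
Proof. by rewrite twistedXC -tauK_F rho_mono. Qed.

Lemma scal_ext_Fconst a y : C (scal_ext a) * Fconst y = Fconst y * C (scal_ext a).
Proof.
rewrite /Fconst -!rmorphM; congr C; rewrite /scal_ext mulr_suml mulr_sumr.
apply: eq_bigr => i _; rewrite !cyclic_mulE !cyclic_mono_mul ?order_gt0 ?order_sigmaK //.
by rewrite addn0 add0n ltn_ord expg0 gal_id sigmaK_F mulrC.
Qed.

Lemma scal_ext_X a : C (scal_ext a) * t = t * C (scal_ext a).
Proof. by rewrite twistedXC rho_scal_ext. Qed.

Definition Bpoly : B -> R := cyclic_lift Fconst t.

(** In D, F is central and tau_tilde fixes D_0; so F and t, hence the images of
the second factor, commute with D_0. *)
Lemma scal_ext_Bpoly a b : C (scal_ext a) * Bpoly b = Bpoly b * C (scal_ext a).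
Proof. by apply: cyclic_lift_comm => [|y]; rewrite ?scal_ext_X ?scal_ext_Fconst. Qed.

Local Notation f := (t ^+ #[tau]%g - Fconst d).

Lemma size_Xn_sub_Fconst : sz f = #[tau]%g.+1.
Proof.
have -> : (f : {poly D}) = 'X^#[tau]%g - (monoD 0 d%:A)%:P.
  by congr (_ - _); apply/polyP=> i; rewrite coefXn; apply: coef_twistedXn.
by rewrite size_XnsubC ?order_gt0.
Qed.

Definition tensor_poly : T -> R := tensor_lift (fun a b => C (scal_ext a) * Bpoly b).

Let const_scal_extD : {morph (fun a : D0 => C (scal_ext a)) : a b / a + b}.
Proof. by move=> a b; rewrite scal_extD rmorphD. Qed.

Lemma tensor_poly_balanced s a b :
  C (scal_ext (s *: a)) * Bpoly b = C (scal_ext a) * Bpoly (s *: b).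
Proof.
by rewrite scal_extZ [Bpoly (s *: b)](cyclic_liftZ Fconst_X) rmorphM -mulrA.
Qed.

Lemma tensor_polyD : {morph tensor_poly : u v / u + v}.
Proof. exact: tensor_lift_mul_additive const_scal_extD. Qed.

Lemma tensor_poly0 : tensor_poly 0 = 0.
Proof. by apply: (addrI (tensor_poly 0)); rewrite -tensor_polyD !addr0. Qed.

Lemma tensor_poly_tens a b : tensor_poly (tens a b) = C (scal_ext a) * Bpoly b.
Proof.
exact: (tensor_lift_mul_tens const_scal_extD (cyclic_liftD Fconst t) tensor_poly_balanced).
Qed.

Lemma tensor_polyM u v :
  congr_modl f (tensor_poly u * tensor_poly v) (tensor_poly (namul u v)).
Proof.
apply: tensor_lift_mul_modl.
- exact: const_scal_extD.
- exact: cyclic_liftD.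
- exact: tensor_poly_balanced.
- by move=> a a'; rewrite -rmorphM -scal_extM.
- exact: cyclic_liftM Fconst_X.
- exact: scal_ext_Bpoly.
Qed.

(** Writing an element of the tensor product on the F_0-basis e^i X_s of D_0, with
coefficients in the second factor, makes the coefficients of its image
explicit: those of b i s reappear, twisted by a power of tau, as coordinates on
the F-basis e^i iota(X_s) of D.  The index i is a natural number because the
coefficients of D_0 and of D have different index types. *)
Definition tensor_of_coord (b : nat -> 'I_(\dim {:L}) -> B) : T :=
  \sum_(i < #[sigma]%g) \sum_(s < \dim {:L}) tens (cyclic_mono sigma c%:A i X`_s) (b i s).

Lemma tensor_of_coord_surj u : exists b, u = tensor_of_coord b.
Proof.
elim/tensor_ind: u => [|u1 u2 [b1 ->] [b2 ->]|a b].
- exists (fun _ _ => 0); rewrite /tensor_of_coord big1 // => i _; rewrite big1 // => s _.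
  by rewrite tens0r.
- exists (fun i s => b1 i s + b2 i s); rewrite /tensor_of_coord -big_split.
  by apply: eq_bigr => i _; rewrite -big_split; apply: eq_bigr => s _; rewrite tensDr.
pose a_ k s := if insub k is Some i then coord X s (a i) else 0.
exists (fun i s => a_ i s *: b).
rewrite {1}(cyclic_decomp a) /tensor_of_coord.
rewrite (big_morph (fun a => tens a b) (tensDl b) (tens0l _ b)); apply: eq_bigr => i _.
rewrite {1}(coord_vbasis (memvf (a i))).
rewrite (big_morph (cyclic_mono _ _ i) (@cyclic_monoD _ _ _ _ i) (@cyclic_mono0 _ _ _ _ i)).
rewrite (big_morph (fun a => tens a b) (tensDl b) (tens0l _ b)); apply: eq_bigr => s _.
by rewrite cyclic_monoZ tensZl tensZr /a_ valK.
Qed.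

Lemma coef_Bpoly b j : (Bpoly b : {poly D})`_j =
  monoD 0 (if insub j is Some i then ((tau ^+ j)^-1)%g (b i) else 0)%:A.
Proof.
rewrite [Bpoly b](cyclic_lift_coefl Fconst_X) coef_twisted_sum.
by case: insubP => [i _ <-|_] //; rewrite scale0r cyclic_mono0.
Qed.

Lemma coef_tensor_poly b j (ltj : (j < #[tau]%g)%N) :
  (tensor_poly (tensor_of_coord b) : {poly D})`_j = \sum_(i < #[sigma]%g)
     monoD i (\sum_(s < \dim {:L}) ((tau ^+ j)^-1)%g (b i s (Ordinal ltj)) *: iota X`_s).
Proof.
rewrite /tensor_of_coord (big_morph _ tensor_polyD tensor_poly0) coef_sum.
apply: eq_bigr => i _; rewrite (big_morph _ tensor_polyD tensor_poly0) coef_sum.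
rewrite (big_morph (cyclic_mono _ _ i) (@cyclic_monoD _ _ _ _ i) (@cyclic_mono0 _ _ _ _ i)).
apply: eq_bigr => s _; rewrite tensor_poly_tens coef_twistedCM coef_Bpoly insubT.
rewrite scal_ext_mono // cyclic_mulE cyclic_mono_mul ?order_gt0 ?order_sigmaK //.
by rewrite addn0 ltn_ord expg0 gal_id mulr_algr.
Qed.

Lemma size_tensor_poly u : (sz (tensor_poly u) <= #[tau]%g)%N.
Proof.
apply: (tensor_lift_closed (Q := fun p : R => sz p <= #[tau]%g)%N) => [|p q|a b].
- by rewrite size_poly0.
- exact: size_twistedD_le.
apply/leq_sizeP=> j le_j.
rewrite coef_twistedCM coef_Bpoly insubN -?leqNgt //.
by rewrite scale0r cyclic_mono0 mulr0.
Qed.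

Lemma tensor_poly_inj u : tensor_poly u = 0 -> u = 0.
Proof.
have [b ->] := tensor_of_coord_surj u => pu0.
rewrite /tensor_of_coord big1 // => i _; rewrite big1 // => s _.
suff -> : b i s = 0 by rewrite tens0r.
apply/ffunP=> [[j ltj]]; rewrite cyclic_coef0.
have := coef_tensor_poly b ltj; rewrite pu0 coef0.
have lti : (i < #[sigmaK]%g)%N by rewrite order_sigmaK.
move/(congr1 (fun z : D => z (Ordinal lti))); rewrite cyclic_coef0.
pose z i := \sum_(s < \dim {:L}) ((tau ^+ j)^-1)%g (b i s (Ordinal ltj)) *: iota X`_s.
rewrite (cyclic_coef_sum _ z) //=.
move/esym=> sum0.
have /freeP freeX := basis_free (composite_basisP iota_F0 disjLF compLF).
have <- : (tau ^+ j)%g (((tau ^+ j)^-1)%g (b i s (Ordinal ltj))) = b i s (Ordinal ltj).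
  by rewrite -galM ?memvf // mulVg gal_id.
rewrite -(rmorph0 (tau ^+ j)%g); congr ((tau ^+ j)%g _).
apply: (freeX (fun s => ((tau ^+ j)^-1)%g (b i s (Ordinal ltj))) _ s).
rewrite -[RHS]sum0; apply: eq_bigr => s' _.
by rewrite (nth_map 0) ?size_tuple.
Qed.

Lemma tensor_poly_surj (p : R) : (sz p <= #[tau]%g)%N -> exists u, tensor_poly u = p.
Proof.
move=> szp.
pose pc j i : K := if insub i is Some l then (p : {poly D})`_j l else 0.
pose b i s : B := [ffun j : 'I_#[tau]%g => (tau ^+ j)%g (coord iX s (pc j i))].
exists (tensor_of_coord b); apply/polyP=> j; have [ltj|le_j] := ltnP j #[tau]%g.
  rewrite coef_tensor_poly [RHS](cyclic_decomp_nat _ (esym order_sigmaK)).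
  apply: eq_bigr => i _; rewrite -/(pc j i) [in RHS](composite_coord (pc j i)).
  congr (cyclic_mono _ _ _ _); apply: eq_bigr => s _.
  by rewrite ffunE /= -galM ?memvf // mulgV gal_id.
by rewrite !nth_default ?(leq_trans _ le_j) // size_tensor_poly.
Qed.

End Comparison.

(** * Division algebras of polynomials modulo f *)

Section PetitAlgebra.
Variables (D : nzRingType) (rho : {rmorphism D -> D}).
Hypothesis divD : forall a : D, a != 0 -> exists b, b * a = 1.
Local Notation P := (twisted_poly rho).
Local Notation sz p := (size (p%R : {poly D})).
Variables (k : fieldType) (A : nonassocAlgType k) (f : P) (Phi : A -> P).
Hypotheses (deg_f : (1 < sz f)%N) (Phi0 : Phi 0 = 0)
           (size_Phi : forall u, (sz (Phi u) < sz f)%N)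
           (Phi_inj : forall u, Phi u = 0 -> u = 0)
           (Phi_surj : forall p, (sz p < sz f)%N -> exists u, Phi u = p)
           (PhiM : forall u v, congr_modl f (Phi u * Phi v) (Phi (namul u v))).

(** The map Phi identifies A with Petit's algebra of f, whose zero divisors are
the pairs of nonzero polynomials of degree less than deg f with product in the
left ideal R f.  A factorization of f is such a pair, with product f itself; the
converse is [twisted_irreducible_zero_divisor]. *)
Lemma petit_division_irreducible : is_division_algebra A <-> twisted_irreducible f.
Proof.
have f0 : f != 0 by rewrite -size_poly_gt0; apply: leq_trans deg_f.
rewrite division_algebra_no_zero_divisor; split=> [[_ noZD]|irr_f].
  split=> [[g [fg _]]|[g [h [lt_g lt_h def_f]]]].
    have g0 : g != 0.
      by apply/eqP=> g0; move/eqP: fg; rewrite g0 mulr0 eq_sym oner_eq0.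
    have := size_twistedM divD f0 g0; rewrite fg [size _]size_poly1.
    move: deg_f g0; rewrite -size_poly_gt0.
    have bound a b : (1 < a -> 0 < b -> 1 = (a + b).-1 -> False)%N by lia.
    exact: bound.
  have [u Phi_u] := Phi_surj lt_g; have [v Phi_v] := Phi_surj lt_h.
  have [r] := PhiM u v; rewrite Phi_u Phi_v -def_f => def_r.
  have uv0 : Phi (namul u v) = (1 - r) * f.
    by rewrite mulrBl mul1r [X in X - _]def_r addrK.
  (* A nonzero multiple of f has at least the degree of f. *)
  have r1 : 1 - r = 0.
    apply/eqP/negPn/negP=> r1; have := size_Phi (namul u v).
    rewrite uv0 size_twistedM //; move: r1; rewrite -size_poly_gt0.
    have bound a b : (0 < a -> (a + b).-1 < b -> False)%N by lia.
    exact: bound.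
  move: uv0; rewrite r1 mul0r => /Phi_inj/noZD[u0|v0].
    by case/eqP: f0; rewrite def_f -Phi_u u0 Phi0 mul0r.
  by case/eqP: f0; rewrite def_f -Phi_v v0 Phi0 mulr0.
split.
  have [u Phi_u] : exists u, Phi u = 1 by apply: Phi_surj; rewrite [size _]size_poly1.
  exists u; apply/eqP=> u0; move/eqP: Phi_u.
  by rewrite u0 Phi0 eq_sym oner_eq0.
move=> u v uv0; have [r] := PhiM u v; rewrite uv0 Phi0 add0r => def_r.
have := twisted_irreducible_zero_divisor divD irr_f def_r.
by case=> // /Phi_inj; [left | right].
Qed.

End PetitAlgebra.

Theorem theorem15 (F0 : fieldType) (L F : splittingFieldType F0) (n m : nat)
  (sigma : gal_of {:L}) (tau : gal_of {:F})
  (dimL : \dim {:L} = n) (galL : galois 1 {:L})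
  (genL : 'Gal({:L} / 1)%g = <[sigma]>%g)
  (dimF : \dim {:F} = m) (galF : galois 1 {:F})
  (genF : 'Gal({:F} / 1)%g = <[tau]>%g)
  (* K, an extension of F, is the composite of F and of the image of L by iota *)
  (K : splittingFieldType F) (iota : {rmorphism L -> K})
  (iota_F0 : forall x : F0, iota x%:A = x%:A%:A)
  (disjLF : linearly_disjoint iota) (compLF : is_composite iota)
  (sigmaK : gal_of {:K}) (sigmaK_L : forall x : L, sigmaK (iota x) = iota (sigma x))
  (tauK : {rmorphism K -> K}) (tauK_F : forall y : F, tauK y%:A = (tau y)%:A)
  (tauK_L : forall x : L, tauK (iota x) = iota x)
  (d : F) (d_neq0 : d != 0) (c : F0) (c_neq0 : c != 0)
  (divD : is_division_algebra (cyclic_algebra sigmaK c%:A%:A))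
  (* rho is the inverse of the ring automorphism tau_tilde of D *)
  (rho : {rmorphism cyclic_algebra sigmaK c%:A%:A -> cyclic_algebra sigmaK c%:A%:A})
  (rhoK : cancel rho (tau_tilde tauK)) (Krho : cancel (tau_tilde tauK) rho) :
  is_division_algebra (tensor (cyclic_algebra sigma c%:A) (cyclic_algebra tau d))
  <->
  twisted_irreducible (twistedX rho ^+ m - twistedC rho (cyclic_mono sigmaK c%:A%:A 0 d%:A)).
Proof.
have ord_tau : #[tau]%g = m.
  by rewrite orderE -genF -(galois_dim galF) dimv1 divn1.
have divD' (a : cyclic_algebra sigmaK (c%:A%:A : K)) : a != 0 -> exists b, b * a = 1.
  by move=> a0; have [_ [g _ gK]] := divD.2 a a0; exists (g 1); apply: gK.
have szf := size_Xn_sub_Fconst tau d rho.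
rewrite -ord_tau.
apply: (@petit_division_irreducible _ rho divD' F0
  (tensor (cyclic_algebra sigma c%:A) (cyclic_algebra tau d))
  (twistedX rho ^+ #[tau]%g - Fconst rho d) (tensor_poly iota rho)).
- by rewrite szf ltnS order_gt0.
- exact: tensor_poly0.
- by move=> u; rewrite szf ltnS (size_tensor_poly iota tauK_F Krho).
- exact: (tensor_poly_inj iota_F0 disjLF compLF sigmaK_L tauK_F Krho).
- move=> p; rewrite szf ltnS.
  exact: (tensor_poly_surj iota_F0 disjLF compLF sigmaK_L tauK_F d Krho).
exact: (tensor_polyM iota_F0 disjLF compLF sigmaK_L tauK_F tauK_L Krho).
Qed.
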